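(* (1) Let $(A,\mu,\alpha)$ be a finite-dimensional simple Hom-alternative algebra. Then its induced alternative algebra $(A,\mu')$, $\mu'=\alpha^{-1}\circ\mu$, is semi-simple. Moreover, $(A,\mu')$ can be decomposed into a direct sum of isomorphic simple ideals. In addition, $\alpha$ acts simply transitively on the simple ideals of the induced alternative algebra. (2) Let $(A,\mu')$ be a simple alternative algebra and $\alpha\in \mathrm{Aut}(A,\mu')$. Then $(A,\mu=\alpha\circ\mu',\alpha)$ is a simple Hom-alternative algebra.
   Context: All vector spaces are over a fixed field $\mathbb{K}$ of characteristic $0$. A Hom-algebra is a triple $(A,\mu,\alpha)$ with $A$ a vector space, $\mu:A\otimes A\to A$ linear and $\alpha:A\to A$ linear; it is multiplicative if $\alpha\circ\mu=\mu\circ(\alpha\otimes\alpha)$. Its Hom-associator is $as_A(x,y,z)=\mu(\mu(x,y),\alpha(z))-\mu(\alpha(x),\mu(y,z))$. A Hom-alternative algebra is a multiplicative Hom-algebra with $as_A(x,x,y)=0$ and $as_A(x,y,y)=0$ for all $x,y\in A$. A two-sided Hom-ideal is a linear subspace $H\subseteq A$ such that $\alpha(H)\subseteq H$ and $\mu(a,b),\mu(b,a)\in H$ for all $a\in A$, $b\in H$. A Hom-alternative algebra $(A,\mu,\alpha)$ with $\alpha\neq 0$ is simple if $\mu(A,A)\neq\{0\}$ and it has no proper two-sided Hom-ideal (i.e. none other than $\{0\}$ and $A$). For a finite-dimensional simple Hom-alternative algebra, $\alpha$ is invertible and $(A,\mu'=\alpha^{-1}\circ\mu)$ is an alternative algebra,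 called the induced alternative algebra, of which $\alpha$ is an automorphism. An alternative algebra is simple if its product is nonzero and it has no two-sided ideal other than $\{0\}$ and itself; it is semi-simple if it is a direct sum of finitely many simple two-sided ideals (ideals that are simple as algebras). ''$\alpha$ acts simply transitively on the simple ideals'' means: if $m$ is the number of simple ideals in the decomposition of $(A,\mu')$ and $A_{1}$ is one of them, then $A=A_1\oplus\alpha(A_1)\oplus\alpha^2(A_1)\oplus\cdots\oplus\alpha^{m-1}(A_1)$, the summands being the simple ideals of the decomposition. *)

(* Defs.v *)
From HB Require Import structures.
From mathcomp Require Import all_boot all_order all_algebra all_fingroup.

Set Implicit Arguments.
Unset Strict Implicit.
Unset Printing Implicit Defensive.

Import GRing.Theory.
Local Open Scope ring_scope.

(* Algebras are given by a carrier A, a product mu (a bilinear map, in place of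
   a linear map on the tensor square) and, for Hom-algebras, a twist alpha.
   Subspaces of a possibly infinite-dimensional A are predicates A -> Prop, so
   that no decidability of membership is assumed. *)

Section Subspaces.
Variables (K : fieldType) (A : lmodType K).
Implicit Type H : A -> Prop.

Definition subspace H : Prop :=
  H 0 /\ (forall (c : K) (x y : A), H x -> H y -> H (c *: x + y)).

Definition trivial_or_full H : Prop :=
  (forall x, H x -> x = 0) \/ (forall x, H x).

Definition two_sided_ideal (mu : A -> A -> A) H : Prop :=
  subspace H /\ (forall a b, H b -> H (mu a b) /\ H (mu b a)).

End Subspaces.

Section HomAlgebras.
Variables (K : fieldType) (A : lmodType K).
Variables (mu : A -> A -> A) (alpha : A -> A).

Definition hom_algebra : Prop :=
  bilinear_for *:%R *:%R mu /\ linear alpha.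

Definition multiplicative_hom_algebra : Prop :=
  hom_algebra /\ {morph alpha : x y / mu x y}.

Definition hom_associator (x y z : A) : A :=
  mu (mu x y) (alpha z) - mu (alpha x) (mu y z).

Definition hom_alternative_algebra : Prop :=
  [/\ multiplicative_hom_algebra,
      forall x y, hom_associator x x y = 0
    & forall x y, hom_associator x y y = 0].

Definition two_sided_hom_ideal (H : A -> Prop) : Prop :=
  two_sided_ideal mu H /\ (forall x, H x -> H (alpha x)).

Definition simple_hom_alternative_algebra : Prop :=
  [/\ hom_alternative_algebra,
      exists x, alpha x != 0,
      exists x y, mu x y != 0
    & forall H : A -> Prop, two_sided_hom_ideal H -> trivial_or_full H].

End HomAlgebras.

Section AlternativeAlgebras.
Variables (K : fieldType) (A : lmodType K) (mu : A -> A -> A).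

Definition associator (x y z : A) : A := mu (mu x y) z - mu x (mu y z).

Definition alternative_algebra : Prop :=
  [/\ bilinear_for *:%R *:%R mu,
      forall x y, associator x x y = 0
    & forall x y, associator x y y = 0].

Definition simple_alternative_algebra : Prop :=
  [/\ alternative_algebra,
      exists x y, mu x y != 0
    & forall H : A -> Prop, two_sided_ideal mu H -> trivial_or_full H].

Definition algebra_automorphism (f : A -> A) : Prop :=
  [/\ linear f, bijective f & {morph f : x y / mu x y}].

End AlternativeAlgebras.

Definition algebra_isomorphic (K : fieldType) (A B : lmodType K)
    (mu : A -> A -> A) (nu : B -> B -> B) : Prop :=
  exists f : A -> B,
    [/\ linear f, bijective f & {morph f : x y / mu x y >-> nu x y}].

Section FiniteDimension.
Variables (K : fieldType) (A : vectType K).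

(* The algebra U for the restriction of mu; the projection vsproj U has no
   effect as soon as U is closed under mu. *)
Definition restr_mul (mu : A -> A -> A) (U : {vspace A})
    (x y : subvs_of U) : subvs_of U :=
  vsproj U (mu (vsval x) (vsval y)).

Definition simple_ideal (mu : A -> A -> A) (U : {vspace A}) : Prop :=
  two_sided_ideal mu (fun x => x \in U) /\
  simple_alternative_algebra (@restr_mul mu U).

Definition direct_sum (m : nat) (U : 'I_m -> {vspace A}) : Prop :=
  directv (\sum_(i < m) U i)%VS /\ (\sum_(i < m) U i)%VS = fullv.

Definition simple_decomposition (mu : A -> A -> A) (m : nat)
    (U : 'I_m -> {vspace A}) : Prop :=
  (forall i, simple_ideal mu (U i)) /\ direct_sum U.

Definition semisimple_alternative_algebra (mu : A -> A -> A) : Prop :=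
  alternative_algebra mu /\
  exists (m : nat) (U : 'I_m -> {vspace A}), simple_decomposition mu U.

(* alpha^-1 o mu; (alpha^-1)%VF is the two-sided inverse of alpha when alpha is
   bijective. *)
Definition induced_mul (mu : A -> A -> A) (alpha : 'End(A)) : A -> A -> A :=
  fun x y => (alpha^-1)%VF (mu x y).

Definition iter_image (alpha : 'End(A)) (k : nat) (U : {vspace A}) :
    {vspace A} :=
  iter k (fun V => alpha @: V)%VS U.

(* For every summand U i0, A is the direct sum of the alpha^k(U i0), k < m, and
   these are, up to a permutation of the indices, the summands U i. *)
Definition acts_simply_transitively (alpha : 'End(A)) (m : nat)
    (U : 'I_m -> {vspace A}) : Prop :=
  forall i0 : 'I_m,
    direct_sum (fun k : 'I_m => iter_image alpha k (U i0)) /\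
    exists s : {perm 'I_m}, forall k : 'I_m, iter_image alpha k (U i0) = U (s k).

End FiniteDimension.

(* Main.v *)
Require Import Defs.
From HB Require Import structures.
From mathcomp Require Import all_boot all_order all_algebra all_fingroup.
From Stdlib Require Import Classical_Prop.

Set Implicit Arguments.
Unset Strict Implicit.
Unset Printing Implicit Defensive.

Import GRing.Theory.
Local Open Scope ring_scope.

(** Part (1). The kernel of [alpha] is a Hom-ideal, so [alpha] is bijective and
    is an automorphism of the induced product.  An [alpha]-invariant ideal of
    the induced algebra is a Hom-ideal, so only 0 and [A] are invariant.  Let
    [V] be a minimal nonzero ideal and [m] the least number such that
    [alpha^m V] meets [S], the sum of the [alpha^k V] for [k < m].  By
    minimality [alpha^m V] lies in [S]; so [S] is invariant, hence [S = A], and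
    the sum is direct by the choice of [m] ([orbit_decomposition]).  The product
    of [V] is not zero because the annihilator of [A] is an invariant ideal, and
    ideals of a direct summand are ideals of [A]; hence the summands are simple.
    For an arbitrary decomposition into simple ideals, [alpha] permutes the
    summands, as a minimal ideal with nonzero product can only be one of them,
    and the sum of one orbit is invariant, hence everything
    ([simple_transitivity]).

    Part (2). The dimension may be infinite, and a Hom-ideal [H] of the twisted
    algebra only satisfies [alpha H <= H] and [alpha (A H + H A) <= H], so it is
    not clear that [H] is an ideal of the original product.  However, if
    [X = alpha^2 H], then everything obtained from [X] by at most two
    multiplications lies in [H].  If the span of these words is an ideal, the
    simplicity of [A] settles the matter.  So the question is whether words of
    three multiplications applied to an element [x] reduce to shorter ones.  In
    an associative algebra they do.  In an alternative algebra, call [s]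
    reducing if [((x s) c) d] is always a combination of words of at most two
    multiplications on [x].  The relation of [word_cycle], which rests on the
    skew-symmetry of the Kleinfeld function, implies that reducing elements are
    closed under products and under commutation with any element, and that all
    associators are reducing.  It follows that the reducing [s] with [A s]
    reducing form an ideal, and that this ideal contains [(s, A, A)] for every
    reducing [s].  Hence, in a simple algebra, either all elements are reducing
    or every associator is nuclear ([reducing_dichotomy]).  If all elements of
    [A] and of its opposite are reducing, then all words of length three reduce.
    Otherwise [X] is replaced by the set of its nuclear elements, on which words
    of length three reduce as well.  This set is nonzero: the nucleus is
    nonzero, since [A] would be associative otherwise, and if [H] is nonzero,
    then every element of [A] is brought into [H] by some power of [alpha]. *)

(** * Linear identities in abelian groups *)

(** Syntax of integer linear combinations.  Both sides of an identity are read
    as such combinations of common atoms, so that comparing coefficients proves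
    the identity in every abelian group. *)
Inductive zexpr : Type :=
| ZVar of nat | ZZero | ZAdd of zexpr & zexpr | ZOpp of zexpr
| ZMuln of zexpr & nat.

Fixpoint zeval (V : zmodType) (env : seq V) (e : zexpr) : V :=
  match e with
  | ZVar i => env`_i
  | ZZero => 0
  | ZAdd e1 e2 => zeval env e1 + zeval env e2
  | ZOpp e1 => - zeval env e1
  | ZMuln e1 n => zeval env e1 *+ n
  end.

Fixpoint zcoef (e : zexpr) (i : nat) : int :=
  match e with
  | ZVar j => (i == j)%:Z
  | ZZero => 0
  | ZAdd e1 e2 => zcoef e1 i + zcoef e2 i
  | ZOpp e1 => - zcoef e1 i
  | ZMuln e1 n => zcoef e1 i * n%:Z
  end.

Lemma zeval_coef (V : zmodType) (env : seq V) (e : zexpr) :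
  zeval env e = \sum_(i < size env) env`_i *~ zcoef e i.
Proof.
elim: e => [j||e1 IH1 e2 IH2|e1 IH1|e1 IH1 n] /=.
- have [lt_j|le_j] := ltnP j (size env).
    rewrite (bigD1 (Ordinal lt_j)) //= eqxx big1 ?addr0 // => i.
    by rewrite -val_eqE /= => /negPf->.
  rewrite nth_default // big1 // => i _.
  by rewrite ltn_eqF // (leq_trans (ltn_ord i)).
- by rewrite big1.
- rewrite IH1 IH2 -big_split /=; apply: eq_bigr => i _.
  by rewrite mulrzDr.
- by rewrite IH1 -sumrN; apply: eq_bigr => i _; rewrite mulrNz.
- rewrite IH1 -sumrMnl; apply: eq_bigr => i _.
  by rewrite mulrzA pmulrn.
Qed.

Lemma zeval_eq (V : zmodType) (env : seq V) (e1 e2 : zexpr) :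
  all (fun i => zcoef e1 i == zcoef e2 i) (iota 0 (size env)) ->
  zeval env e1 = zeval env e2.
Proof.
move=> /allP coef_eq; rewrite !zeval_coef; apply: eq_bigr => i _.
by congr (_ *~ _); apply/eqP/coef_eq; rewrite mem_iota /= add0n.
Qed.

Ltac zatoms l t :=
  lazymatch t with
  | ?a + ?b => let l1 := zatoms l a in zatoms l1 b
  | - ?a => zatoms l a
  | ?a *+ ?n => zatoms l a
  | 0 => l
  | _ => match l with
         | context [t :: _] => l
         | _ => constr:(t :: l)
         end
  end.

Ltac zindex l t :=
  match l with
  | t :: _ => constr:(0%N)
  | _ :: ?r => let i := zindex r t in constr:(i.+1)
  end.

Ltac zreify l t :=
  lazymatch t with
  | ?a + ?b => let x := zreify l a in let y := zreify l b in constr:(ZAdd x y)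
  | - ?a => let x := zreify l a in constr:(ZOpp x)
  | ?a *+ ?n => let x := zreify l a in constr:(ZMuln x n)
  | 0 => constr:(ZZero)
  | _ => let i := zindex l t in constr:(ZVar i)
  end.

Ltac abel :=
  match goal with
  | |- @eq ?V ?a ?b =>
    let l0 := zatoms (@nil V) a in
    let l := zatoms l0 b in
    let x := zreify l a in
    let y := zreify l b in
    apply: (@zeval_eq _ l x y); vm_compute; reflexivity
  end.

(** Adds a known equation to a goal; a chain of these followed by [abel] proves
    that an equation is a linear consequence of others. *)
Lemma use_eq (V : zmodType) (l r a b : V) : l = r -> a + r = b + l -> a = b.
Proof. by move=> -> /addIr. Qed.

(** * Spans of short multiplication words *)

Section WordSpan.
Variables (K : fieldType) (A : lmodType K).

(** The elements obtained from [X] by linear combinations and at most [j] left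
    or right multiplications by arbitrary elements.  The multiplications are
    counted rather than collected in the ideal generated by [X], because a
    Hom-ideal tolerates a bounded number of them only. *)
Inductive word_span (mu : A -> A -> A) (X : A -> Prop) : nat -> A -> Prop :=
| word_gen j x of X x : word_span mu X j x
| word_zero j : word_span mu X j 0
| word_lin j c x y of word_span mu X j x & word_span mu X j y :
    word_span mu X j (c *: x + y)
| word_left j a x of word_span mu X j x : word_span mu X j.+1 (mu a x)
| word_right j a x of word_span mu X j x : word_span mu X j.+1 (mu x a).

Variables (mu : A -> A -> A) (X : A -> Prop).

Lemma wordD j x y :
  word_span mu X j x -> word_span mu X j y -> word_span mu X j (x + y).
Proof. by move=> Wx Wy; rewrite -[x]scale1r; apply: word_lin. Qed.

Lemma wordZ j c x : word_span mu X j x -> word_span mu X j (c *: x).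
Proof. by move=> Wx; rewrite -[c *: x]addr0; apply: word_lin => //; apply: word_zero. Qed.

Lemma wordN j x : word_span mu X j x -> word_span mu X j (- x).
Proof. by move=> Wx; rewrite -scaleN1r; apply: wordZ. Qed.

Lemma wordB j x y :
  word_span mu X j x -> word_span mu X j y -> word_span mu X j (x - y).
Proof. by move=> Wx Wy; apply/wordD/wordN. Qed.

Lemma wordMn j n x : word_span mu X j x -> word_span mu X j (x *+ n).
Proof. by rewrite -scaler_nat; apply: wordZ. Qed.

Lemma wordW j x : word_span mu X j x -> word_span mu X j.+1 x.
Proof.
elim=> {j x} [j x Xx|j|j c x y _ Wx _ Wy|j a x _ Wx|j a x _ Wx].
- exact: word_gen.
- exact: word_zero.
- exact: word_lin.
- exact: word_left.
- exact: word_right.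
Qed.

Lemma word_mono (Y : A -> Prop) j x :
  (forall y, Y y -> X y) -> word_span mu Y j x -> word_span mu X j x.
Proof.
move=> YX; elim=> {j x} [j x /YX Xx|j|j c x y _ Wx _ Wy|j a x _ Wx|j a x _ Wx].
- exact: word_gen.
- exact: word_zero.
- exact: word_lin.
- exact: word_left.
- exact: word_right.
Qed.

(** Left and right multiplications enter symmetrically; this transports
    reductions of words from the opposite algebra. *)
Lemma word_op j x :
  word_span (fun a b => mu b a) X j x -> word_span mu X j x.
Proof.
elim=> {j x} [j x Xx|j|j c x y _ Wx _ Wy|j a x _ Wx|j a x _ Wx].
- exact: word_gen.
- exact: word_zero.
- exact: word_lin.
- exact: word_right.
- exact: word_left.
Qed.

Lemma word0_gen x : subspace X -> word_span mu X 0 x -> X x.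
Proof.
move=> [X0 Xlin]; move: {-2}0%N (erefl 0%N) => j j0 Wx.
by elim: Wx j0 => {j x} // j c x y _ IHx _ IHy j0; apply: Xlin; auto.
Qed.

Lemma word_succ_ind j (Q : A -> Prop) :
    Q 0 -> (forall c x y, Q x -> Q y -> Q (c *: x + y)) ->
    (forall x, word_span mu X j x -> Q x) ->
    (forall a x, word_span mu X j x -> Q (mu a x)) ->
    (forall a x, word_span mu X j x -> Q (mu x a)) ->
  forall y, word_span mu X j.+1 y -> Q y.
Proof.
move=> Q0 Qlin Qj Ql Qr y; move: {-2}j.+1 (erefl j.+1) => k kj Wy.
elim: Wy kj => {k y}
  [k x Xx kj|k _|k c x y _ IHx _ IHy kj|k a x Wx _ [kj]|k a x Wx _ [kj]].
- exact/Qj/word_gen.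
- exact: Q0.
- by apply: Qlin; auto.
- by apply: Ql; rewrite -kj.
- by apply: Qr; rewrite -kj.
Qed.

End WordSpan.

Ltac in_word_span :=
  lazymatch goal with
  | |- word_span _ _ _ (_ + _) => apply: wordD; in_word_span
  | |- word_span _ _ _ (- _) => apply: wordN; in_word_span
  | |- word_span _ _ _ (_ *+ _) => apply: wordMn; in_word_span
  | |- _ => first
    [ assumption
    | solve [apply: word_gen; done]
    | solve [apply: word_left; in_word_span]
    | solve [apply: word_right; in_word_span]
    | solve [apply: wordW; assumption] ]
  end.

(** * Identities of alternative algebras *)

Section AlternativeIdentities.
Variables (K : fieldType) (A : lmodType K) (mu : A -> A -> A).
Hypothesis altA : alternative_algebra mu.

Local Notation "x ** y" := (mu x y) (at level 40, left associativity).
Local Notation asc := (associator mu).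

Lemma alt_mulDl x y z : (x + y) ** z = x ** z + y ** z.
Proof.
by case: altA => -[mul_l mul_r] _ _; have := mul_l z 1 x y; rewrite /= !scale1r.
Qed.

Lemma alt_mulDr x y z : z ** (x + y) = z ** x + z ** y.
Proof.
by case: altA => -[mul_l mul_r] _ _; have := mul_r z 1 x y; rewrite /= !scale1r.
Qed.

Lemma alt_mul0l x : 0 ** x = 0.
Proof. by apply: (addrI (0 ** x)); rewrite -alt_mulDl !addr0. Qed.

Lemma alt_mul0r x : x ** 0 = 0.
Proof. by apply: (addrI (x ** 0)); rewrite -alt_mulDr !addr0. Qed.

Lemma alt_mulZl c x y : (c *: x) ** y = c *: (x ** y).
Proof.
by case: altA => -[mul_l _] _ _; have := mul_l y c x 0; rewrite /= !addr0 alt_mul0l addr0.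
Qed.

Lemma alt_mulZr c x y : x ** (c *: y) = c *: (x ** y).
Proof.
by case: altA => -[_ mul_r] _ _; have := mul_r x c y 0; rewrite /= !addr0 alt_mul0r addr0.
Qed.

Lemma alt_mulNl x y : (- x) ** y = - (x ** y).
Proof. by rewrite -scaleN1r alt_mulZl scaleN1r. Qed.

Lemma alt_mulNr x y : x ** (- y) = - (x ** y).
Proof. by rewrite -scaleN1r alt_mulZr scaleN1r. Qed.

Lemma alt_mulMnl x y n : (x *+ n) ** y = (x ** y) *+ n.
Proof. by elim: n => [|n IHn]; rewrite ?mulr0n ?alt_mul0l // !mulrS alt_mulDl IHn. Qed.

Lemma alt_mulMnr x y n : x ** (y *+ n) = (x ** y) *+ n.
Proof. by elim: n => [|n IHn]; rewrite ?mulr0n ?alt_mul0r // !mulrS alt_mulDr IHn. Qed.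

Definition alt_mulE := (alt_mulDl, alt_mulDr, alt_mulNl, alt_mulNr).

Definition commutator x y : A := x ** y - y ** x.

Lemma ascDl x x' y z : asc (x + x') y z = asc x y z + asc x' y z.
Proof. by rewrite /associator !alt_mulE; abel. Qed.

Lemma ascDm x y y' z : asc x (y + y') z = asc x y z + asc x y' z.
Proof. by rewrite /associator !alt_mulE; abel. Qed.

Lemma ascDr x y z z' : asc x y (z + z') = asc x y z + asc x y z'.
Proof. by rewrite /associator !alt_mulE; abel. Qed.

Lemma ascNl x y z : asc (- x) y z = - asc x y z.
Proof. by rewrite /associator !alt_mulE; abel. Qed.

Lemma asc_swapl x y z : asc y x z = - asc x y z.
Proof.
have [_ alt_l _] := altA; apply/eqP; rewrite -addr_eq0; apply/eqP.
by have := alt_l (x + y) z; rewrite ascDl !ascDm !alt_l add0r addr0 addrC.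
Qed.

Lemma asc_swapr x y z : asc x z y = - asc x y z.
Proof.
have [_ _ alt_r] := altA; apply/eqP; rewrite -addr_eq0; apply/eqP.
by have := alt_r x (y + z); rewrite ascDr !ascDm !alt_r add0r addr0 addrC.
Qed.

Lemma asc_rot x y z : asc y z x = asc x y z.
Proof. by rewrite asc_swapr asc_swapl opprK. Qed.

(** This identity holds for every bilinear product; with the skew-symmetry of
    the associator it yields the identities below. *)
Lemma teichmuller w x y z :
  asc (w ** x) y z - asc w (x ** y) z + asc w x (y ** z) =
  w ** asc x y z + asc w x y ** z.
Proof. by rewrite /associator !alt_mulE; abel. Qed.

(** The defect of the associator from being a derivation in its first
    argument.  It is skew-symmetric in its four arguments, and this is what
    allows factors to be moved around in long words. *)
Definition kleinfeld w x y z : A :=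
  asc (w ** x) y z - x ** asc w y z - asc x y z ** w.

(** The Teichmuller identity, rewritten by the skew-symmetry of the associator.
    The right-hand side changes sign under a cyclic shift of the variables,
    which gives [kleinfeld_rot]. *)
Lemma kleinfeld_sum w x y z :
  kleinfeld w x y z - kleinfeld x y z w + kleinfeld y z w x =
  commutator w (asc x y z) - commutator x (asc y z w)
  + commutator y (asc z w x) - commutator z (asc w x y).
Proof.
have teich := teichmuller w x y z.
rewrite -(asc_rot w (x ** y) z) (asc_rot (y ** z) w x) in teich.
rewrite /kleinfeld /commutator.
rewrite -(asc_rot w y z) -(asc_rot x z w) -(asc_rot y w x).
by apply: (use_eq teich); abel.
Qed.

Lemma kleinfeld_rot w x y z : kleinfeld z w x y = - kleinfeld w x y z.
Proof.
by apply: (use_eq (kleinfeld_sum w x y z)); apply: (use_eq (kleinfeld_sum x y z w)); abel.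
Qed.

Lemma kleinfeld_swapr w x y z : kleinfeld w x z y = - kleinfeld w x y z.
Proof. by rewrite /kleinfeld !(asc_swapr _ y z) !alt_mulE; abel. Qed.

Lemma kleinfeld_pair w x y z : kleinfeld y z w x = kleinfeld w x y z.
Proof. by rewrite kleinfeld_rot kleinfeld_rot opprK. Qed.

Lemma kleinfeld_swapl w x y z : kleinfeld x w y z = - kleinfeld w x y z.
Proof. by rewrite -kleinfeld_pair kleinfeld_swapr kleinfeld_pair. Qed.

(** Three times the function is the sum in [kleinfeld_sum], and twice the
    function is obtained in two ways by exchanging a pair of arguments; the
    terms other than associators cancel. *)
Lemma kleinfeldE w x y z :
  kleinfeld w x y z = asc (commutator w x) y z + asc (commutator y z) w x.
Proof.
have skew u v s t : asc (commutator u v) s t + commutator u (asc v s t)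
    - commutator v (asc u s t) = kleinfeld u v s t *+ 2.
  rewrite mulr2n -{2}[kleinfeld _ _ _ _]opprK -(kleinfeld_swapl u v s t).
  by rewrite /kleinfeld /commutator ascDl ascNl; abel.
have sum := kleinfeld_sum w x y z.
rewrite (kleinfeld_rot y z w x) opprK (kleinfeld_pair w x y z) in sum.
apply: (use_eq (esym sum)).
apply: (use_eq (esym (skew w x y z))); apply: (use_eq (esym (skew y z w x))).
by rewrite (kleinfeld_pair w x y z) -(asc_rot w y z) -(asc_rot y w x); abel.
Qed.

(** The Jacobian is the alternating sum of the six associators, all equal up to
    sign. *)
Lemma jacobi a b c :
  commutator (commutator a b) c + commutator (commutator b c) a
  + commutator (commutator c a) b = asc a b c *+ 6.
Proof.
have -> : commutator (commutator a b) c + commutator (commutator b c) a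
    + commutator (commutator c a) b =
    asc a b c - asc b a c + asc b c a - asc a c b + asc c a b - asc c b a.
  by rewrite /commutator /associator !alt_mulE; abel.
by rewrite (asc_swapl a b c) (asc_swapr a b c) (asc_swapr c a b)
           (asc_rot a b c) -(asc_rot c a b); abel.
Qed.

Hypothesis charK0 : [pchar K] =i pred0.

Lemma natr_neq0_char0 n : (0 < n)%N -> n%:R != 0 :> K.
Proof. by move=> n_gt0; apply/negP => /(natf0_pchar n_gt0) [p]; rewrite charK0. Qed.

Lemma mulrn_inj_char0 n (x y : A) : (0 < n)%N -> x *+ n = y *+ n -> x = y.
Proof.
move=> n_gt0; rewrite -!scaler_nat => /(congr1 ( *:%R n%:R^-1)).
by rewrite !scalerA mulVf ?scale1r // natr_neq0_char0.
Qed.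

(** The cyclic sums of the Teichmuller identity and of the symmetry
    [kleinfeld_pair] combine to three times this identity.  It expresses the
    cyclic sum of [(x (a b)) c] by words that multiply [x] only once. *)
Lemma asc_mul_cycle x a b c :
  asc x (a ** b) c + asc x (b ** c) a + asc x (c ** a) b
  = commutator (asc a b c) x.
Proof.
have teich u v w : asc (x ** u) v w - asc x (u ** v) w - asc x (v ** w) u
    = x ** asc u v w + asc x u v ** w.
  by rewrite -teichmuller -(asc_swapr x (v ** w) u).
have klein u v w : - asc x (v ** w) u - w ** asc x u v - asc x u w ** v
    = asc (x ** u) v w - u ** asc x v w - asc u v w ** x.
  have := kleinfeld_pair x u v w; rewrite /kleinfeld => <-.
  rewrite -(asc_rot (v ** w) x u) (asc_swapr x (v ** w) u).
  by rewrite -(asc_rot v x u) -(asc_rot w x u).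
apply: (@mulrn_inj_char0 3) => //.
apply: (use_eq (esym (teich a b c))); apply: (use_eq (esym (teich b c a))).
apply: (use_eq (esym (teich c a b))).
apply: (use_eq (esym (klein a b c))); apply: (use_eq (esym (klein b c a))).
apply: (use_eq (esym (klein c a b))).
rewrite /commutator !(asc_swapr x b a, asc_swapr x c b, asc_swapr x a c).
by rewrite (asc_rot a b c) -(asc_rot c a b) !alt_mulE; abel.
Qed.

(** * Reduction of words of three multiplications *)

Lemma mulr_jordan x a b :
  (x ** a) ** b + (x ** b) ** a = x ** (a ** b + b ** a).
Proof.
by apply: (use_eq (asc_swapr x a b)); rewrite alt_mulDr /associator; abel.
Qed.

(** Modulo words of length one, the map [(u, v) |-> (x u) v] satisfies the
    defining relation of cyclic one-cocycles of the product. *)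
Lemma word_cycle x a b c :
  word_span mu (eq x) 1
    ((x ** (a ** b)) ** c + (x ** (b ** c)) ** a + (x ** (c ** a)) ** b).
Proof.
have -> : (x ** (a ** b)) ** c + (x ** (b ** c)) ** a + (x ** (c ** a)) ** b =
    x ** ((a ** b) ** c) + x ** ((b ** c) ** a) + x ** ((c ** a) ** b)
    + (asc a b c ** x - x ** asc a b c).
  move: (asc_mul_cycle x a b c); rewrite /commutator; set D := asc a b c.
  by move=> e; apply: (use_eq e); rewrite /associator; abel.
in_word_span.
Qed.

Definition rword x a b c := ((x ** a) ** b) ** c.

Local Notation inM2 x := (word_span mu (eq x) 2).

Lemma rword_swap12 x a b c : inM2 x (rword x a b c + rword x b a c).
Proof. rewrite /rword -alt_mulDl mulr_jordan; in_word_span. Qed.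

Lemma rword_swap23 x a b c : inM2 x (rword x a b c + rword x a c b).
Proof. rewrite /rword mulr_jordan; in_word_span. Qed.

Lemma rword_cycle x a b c d :
  inM2 x (rword x (a ** b) c d + rword x (b ** c) a d + rword x (c ** a) b d).
Proof.
by rewrite /rword -!alt_mulDl; apply: word_right; exact: word_cycle.
Qed.

(** Modulo words of length two, [cword x] has the symmetries of a curvature
    tensor: it is skew in each pair of arguments and satisfies the Bianchi
    identity.  Therefore it is symmetric under the exchange of the pairs. *)
Definition cword x a b c d := rword x (commutator a b) c d.

Lemma cwordC x a b c d : cword x b a c d = - cword x a b c d.
Proof. by rewrite /cword /rword /commutator !alt_mulE; abel. Qed.

Lemma cword_swap34 x a b c d : inM2 x (cword x a b c d + cword x a b d c).
Proof. exact: rword_swap23. Qed.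

Lemma cword_bianchi x a b c d :
  inM2 x (cword x a b c d + cword x b c a d + cword x c a b d).
Proof.
have := wordB (rword_cycle x a b c d) (rword_cycle x b a c d).
by congr (inM2 x _); rewrite /cword /rword /commutator !alt_mulE; abel.
Qed.

Lemma cword_pair x a b c d : inM2 x (cword x a b c d - cword x c d a b).
Proof.
have two_neq0 : 2%:R != 0 :> K by exact: natr_neq0_char0.
rewrite -[_ - _]scale1r -(mulVf two_neq0) -scalerA; apply: wordZ; rewrite scaler_nat.
have B := cword_bianchi x; have S := cword_swap34 x.
move: (B a b c d) (B b c d a) (B c d a b) (B d a b c) => B1 B2 B3 B4.
move: (S a b c d) (S b d c a) (S a d b c) (S c a b d) (S b c d a) (S c d a b)
  => S1 S2 S3 S4 S5 S6.
(* The classical octahedron argument: a signed sum of four Bianchi identities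
   gives twice the difference, up to exchanges of the last two arguments. *)
have := wordB (wordB (wordD (wordD (wordB (wordD (wordB B1 B4) B2) B3) S1) S2)
                (wordD S3 S4)) (wordD S5 S6).
congr (inM2 x _).
by rewrite !(cwordC x b d) !(cwordC x a d) !(cwordC x c a); abel.
Qed.

(** * Reducing elements of an alternative algebra *)

Definition reducing s := forall x c d, inM2 x (rword x s c d).

(** In the relation [rword_cycle] for [s], [t] and [c], the other two terms
    contain the factor [t] or [s], which skew-symmetry moves to the front. *)
Lemma reducing_mul s t : reducing s -> reducing t -> reducing (s ** t).
Proof.
move=> Rs Rt x c d.
have -> : rword x (s ** t) c d =
    (rword x (s ** t) c d + rword x (t ** c) s d + rword x (c ** s) t d)
    - (rword x (t ** c) s d + rword x s (t ** c) d) + rword x s (t ** c) d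
    - (rword x (c ** s) t d + rword x t (c ** s) d) + rword x t (c ** s) d.
  by abel.
apply: wordD; [apply: wordB; [apply: wordD; [apply: wordB|]|]|].
- exact: rword_cycle.
- exact: rword_swap12.
- exact: Rs.
- exact: rword_swap12.
- exact: Rt.
Qed.

(** The pair symmetry of [cword] exchanges [commutator s a] for a word in which
    [s] itself is a factor. *)
Lemma reducing_comm s a : reducing s -> reducing (commutator s a).
Proof.
move=> Rs x c d.
have -> : rword x (commutator s a) c d =
    (cword x s a c d - cword x c d s a)
    + (rword x (commutator c d) s a + rword x s (commutator c d) a)
    - rword x s (commutator c d) a by rewrite /cword; abel.
apply: wordB; last exact: Rs.
by apply: wordD; [exact: cword_pair | exact: rword_swap12].
Qed.

Lemma reducingD s t : reducing s -> reducing t -> reducing (s + t).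
Proof.
by move=> Rs Rt x c d; rewrite /rword !alt_mulE; apply: wordD; [exact: Rs|exact: Rt].
Qed.

Lemma reducingZ k s : reducing s -> reducing (k *: s).
Proof.
by move=> Rs x c d; rewrite /rword alt_mulZr !alt_mulZl; apply: wordZ; exact: Rs.
Qed.

Lemma reducingN s : reducing s -> reducing (- s).
Proof. by rewrite -scaleN1r; exact: reducingZ. Qed.

Lemma reducingB s t : reducing s -> reducing t -> reducing (s - t).
Proof. by move=> Rs Rt; apply/reducingD/reducingN. Qed.

(** By the Jacobi identity the associator is a sum of iterated commutators.
    The pair symmetry and the skew-symmetry turn that sum into a cyclic sum of
    [cword x a b c q], with [q] the commutator of [d] and [e], and this vanishes
    by the Bianchi identity. *)
Lemma reducing_asc a b c : reducing (asc a b c).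
Proof.
move=> x d e.
have six_neq0 : 6%:R != 0 :> K by exact: natr_neq0_char0.
rewrite -[rword _ _ _ _]scale1r -(mulVf six_neq0) -scalerA; apply: wordZ.
rewrite scaler_nat /rword -2!alt_mulMnl -alt_mulMnr -jacobi.
pose q := commutator d e.
pose R u v w := cword x (commutator u v) w d e - cword x d e (commutator u v) w.
have RP u v w : inM2 x (R u v w) by exact: cword_pair.
pose S u v w := cword x d e (commutator u v) w + cword x u v q w.
have SP u v w : inM2 x (S u v w) by exact: rword_swap12.
pose T u v w := cword x u v q w + cword x u v w q.
have TP u v w : inM2 x (T u v w) by exact: cword_swap34.
have := cword_bianchi x a b c q => B.
have -> : x ** (commutator (commutator a b) c + commutator (commutator b c) a
    + commutator (commutator c a) b) ** d ** e =
  R a b c + R b c a + R c a b + S a b c + S b c a + S c a b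
  - T a b c - T b c a - T c a b
  + (cword x a b c q + cword x b c a q + cword x c a b q).
  by rewrite /R /S /T {1 3 5}/cword /rword 2!alt_mulDr !alt_mulDl; abel.
by repeat first
  [exact: B | exact: RP | exact: SP | exact: TP | apply: wordB | apply: wordD].
Qed.

(** Associators are reducing, so brackets can be shifted freely, and
    commutators with reducing elements are reducing, so factors can be moved
    from the right to the left. *)
Lemma reducing_core_ideal :
  two_sided_ideal mu (fun s => reducing s /\ forall a, reducing (a ** s)).
Proof.
split=> [|b s [Rs Rls]].
  split=> [|c s t [Rs Rls] [Rt Rlt]].
    have R0 : reducing 0.
      by move=> x c d; rewrite /rword alt_mul0r !alt_mul0l; apply: word_zero.
    by split=> // a; rewrite alt_mul0r.
  split=> [|a]; first by apply: reducingD => //; apply: reducingZ.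
  by rewrite alt_mulDr alt_mulZr; apply: reducingD => //; apply: reducingZ.
have Rlls a : reducing (a ** (b ** s)).
  have -> : a ** (b ** s) = (a ** b) ** s - asc a b s by rewrite /associator; abel.
  by apply: reducingB => //; apply: reducing_asc.
split; split => //.
  have -> : s ** b = commutator s b + b ** s by rewrite /commutator; abel.
  by apply: reducingD => //; apply: reducing_comm.
move=> a.
have -> : a ** (s ** b) =
    commutator (a ** s) b + (b ** a) ** s - asc b a s - asc a s b.
  by rewrite /commutator /associator; abel.
do 2?[apply: reducingB; last exact: reducing_asc].
by apply: reducingD => //; apply: reducing_comm.
Qed.

(** The definition of the Kleinfeld function writes [a (u, v, w)] as an
    associator minus [(a, v, w) u] minus a sum of associators. *)
Lemma reducing_core_asc u v w :
  reducing u -> reducing (asc u v w) /\ forall a, reducing (a ** asc u v w).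
Proof.
move=> Ru; split=> [|a]; first exact: reducing_asc.
have -> : a ** asc u v w = asc (u ** a) v w - asc a v w ** u - kleinfeld u a v w.
  by rewrite /kleinfeld; abel.
rewrite kleinfeldE; apply: reducingB; last by apply: reducingD; apply: reducing_asc.
by apply: reducingB; [|apply: reducing_mul => //]; apply: reducing_asc.
Qed.

Definition nuclear n := forall a b, asc n a b = 0.

(** If the ideal of [reducing_core_ideal] is zero, then associators with a
    reducing first entry vanish; in particular reducing elements, such as
    associators, are nuclear. *)
Lemma reducing_dichotomy :
    (forall H : A -> Prop, two_sided_ideal mu H -> trivial_or_full H) ->
  (forall s, reducing s) \/ (forall a b c, nuclear (asc a b c)).
Proof.
move=> simpleA; have [core0|coreA] := simpleA _ reducing_core_ideal.
  right=> a b c u v; apply/core0/reducing_core_asc; exact: reducing_asc.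
by left=> s; have [] := coreA s.
Qed.

(** The next two equations trade an outer left multiplication for right
    multiplications and shorter words. *)
Lemma mul_left_left a b y :
  a ** (b ** y) = y ** (a ** b) + (a ** b) ** y - (y ** a) ** b.
Proof. by apply: (use_eq (esym (asc_rot y a b))); rewrite /associator; abel. Qed.

Lemma mul_left_right a b y :
  a ** (y ** b) = (a ** y) ** b + (y ** a) ** b - y ** (a ** b).
Proof. by apply: (use_eq (esym (asc_swapl a y b))); rewrite /associator; abel. Qed.

(** All words of length three on [x] reduce to right multiplications of [x a]
    and of [a x], which are the words of the two hypotheses. *)
Lemma word_span2_ideal (X : A -> Prop) :
    subspace X ->
    (forall x, X x -> forall a b c, word_span mu X 2 (rword x a b c)) ->
    (forall x, X x -> forall a b c, word_span mu X 2 (rword a x b c)) ->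
  two_sided_ideal mu (word_span mu X 2).
Proof.
move=> subX rightX leftX.
pose two_more y := forall b c,
  word_span mu X 2 ((b ** y) ** c) /\ word_span mu X 2 ((y ** b) ** c).
have two_moreP : forall y, word_span mu X 1 y -> two_more y.
  apply: word_succ_ind.
  - by move=> b c; rewrite alt_mul0r !alt_mul0l; split; apply: word_zero.
  - move=> k x y IHx IHy b c; rewrite alt_mulDr alt_mulZr !alt_mulDl !alt_mulZl.
    by have [? ?] := IHx b c; have [? ?] := IHy b c; split; apply: word_lin.
  - by move=> x Wx b c; split; in_word_span.
  - move=> a x /(word0_gen subX) Xx b c; split; last exact: leftX.
    rewrite mul_left_left alt_mulDl alt_mulDl alt_mulNl; apply: wordB; last exact: rightX.
    by in_word_span.
  - move=> a x /(word0_gen subX) Xx b c; split; last exact: rightX.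
    rewrite mul_left_right alt_mulDl alt_mulDl alt_mulNl.
    apply: wordB; first by apply: wordD; [apply: leftX | apply: rightX].
    by in_word_span.
split; first by split=> [|c x y]; [apply: word_zero | apply: word_lin].
pose one_more y := forall a,
  word_span mu X 2 (a ** y) /\ word_span mu X 2 (y ** a).
suff one_moreP : forall y, word_span mu X 2 y -> one_more y by move=> a y /one_moreP.
apply: word_succ_ind.
- by move=> a; rewrite alt_mul0r alt_mul0l; split; apply: word_zero.
- move=> k x y IHx IHy a; rewrite alt_mulDr alt_mulZr alt_mulDl alt_mulZl.
  by have [? ?] := IHx a; have [? ?] := IHy a; split; apply: word_lin.
- by move=> x Wx a; split; in_word_span.
- move=> b x Wx a; split; last by case: (two_moreP x Wx b a).
  rewrite mul_left_left; apply: wordB; first by in_word_span.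
  by case: (two_moreP x Wx a b).
- move=> b x Wx a; split; last by case: (two_moreP x Wx b a).
  rewrite mul_left_right; apply: wordB; last by in_word_span.
  by case: (two_moreP x Wx a b) => ? ?; apply: wordD.
Qed.

Lemma nuclear_subspace : subspace nuclear.
Proof.
split=> [a b|c x y Nx Ny a b]; first by rewrite /associator !alt_mul0l subrr.
rewrite ascDl Ny addr0 /associator !alt_mulZl -scalerBr.
by have := Nx a b; rewrite /associator => ->; rewrite scaler0.
Qed.

(** For nuclear [x] the brackets in [((x a) b) c] can be moved away from [x],
    and the associator of [a x], [b] and [c] equals [- x (b, a, c)]. *)
Lemma nuclear_word_ideal (X : A -> Prop) :
    subspace X -> (forall x, X x -> nuclear x) ->
  two_sided_ideal mu (word_span mu X 2).
Proof.
move=> subX nucX; apply: word_span2_ideal => // x Xx a b c; have nx := nucX x Xx.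
  have xM u v : (x ** u) ** v = x ** (u ** v).
    by apply/eqP; rewrite -subr_eq0; apply/eqP/nx.
  by rewrite /rword !xM; in_word_span.
have asc_xa : asc (x ** b) a c = x ** asc b a c.
  by have := teichmuller x b a c; rewrite !nx subr0 addr0 alt_mul0l addr0.
have -> : rword a x b c = (a ** x) ** (b ** c) - x ** asc b a c.
  have := teichmuller a x b c.
  rewrite (asc_swapl (x ** b) a c) asc_xa (asc_swapl x a) (asc_swapl x a) !nx.
  rewrite oppr0 alt_mul0r alt_mul0l; move: (asc b a c) => d e.
  by apply: (use_eq e); rewrite /associator /rword; abel.
by in_word_span.
Qed.

End AlternativeIdentities.

(** * Twisting a simple alternative algebra by an automorphism *)

Section Twist.
Variables (K : fieldType) (A : lmodType K) (mu : A -> A -> A) (alpha : A -> A).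
Hypothesis charK0 : [pchar K] =i pred0.

Lemma opposite_alternative :
  alternative_algebra mu -> alternative_algebra (fun a b => mu b a).
Proof.
move=> [[mul_l mul_r] alt_l alt_r]; split; first by split=> u; [apply: mul_r|apply: mul_l].
  by move=> x y; apply/eqP; rewrite /associator -opprB oppr_eq0; apply/eqP/alt_r.
by move=> x y; apply/eqP; rewrite /associator -opprB oppr_eq0; apply/eqP/alt_l.
Qed.

Hypothesis altA : alternative_algebra mu.
Hypothesis simpleA : forall H : A -> Prop, two_sided_ideal mu H -> trivial_or_full H.

(** The dichotomy is applied to [A] and to its opposite.  The latter reduces
    the words made of left multiplications, and these are exchanged for the
    words [((a x) b) c] by [mul_left_left]. *)
Lemma words_reduce_or_nuclear :
  (forall x a b c, word_span mu (eq x) 2 (rword mu x a b c)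
     /\ word_span mu (eq x) 2 (rword mu a x b c))
  \/ (forall a b c, nuclear mu (associator mu a b c)).
Proof.
have altB := opposite_alternative altA.
have simpleB (H : A -> Prop) :
    two_sided_ideal (fun a b => mu b a) H -> trivial_or_full H.
  move=> [subH idH]; apply: simpleA; split=> // a b /(idH a) [].
  by split.
have asc_op x y z :
    associator (fun a b => mu b a) x y z = - associator mu z y x.
  by rewrite /associator opprB.
have [redA|] := reducing_dichotomy altA charK0 simpleA; last by right.
have [redB|nucB] := reducing_dichotomy altB charK0 simpleB; last first.
  right=> a b c u v; have := nucB c b a v u.
  rewrite !asc_op -(asc_rot altA (associator mu a b c)).
  move: (associator mu a b c) => n /eqP; rewrite oppr_eq0 => /eqP asc0.
  by apply: oppr_inj; rewrite oppr0 -[RHS]asc0 /associator !(alt_mulE altA); abel.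
left=> x a b c; split; first exact: redA.
rewrite /rword [mu (mu _ b) c](_ : _ = mu (mu a x) (mu b c) + mu (mu b c) (mu a x)
   - mu b (mu c (mu a x))).
  apply: wordB; first by in_word_span.
  exact/word_op/redB.
by rewrite (mul_left_left altA b c); abel.
Qed.

Hypothesis prodA : exists x y, mu x y != 0.
Hypothesis autA : algebra_automorphism mu alpha.

(** If [H] is the Hom-ideal, [X] is [alpha^2 H]: each multiplication is paid
    for by one application of [alpha], so two of them are affordable. *)
Lemma twist_ideal_trivial (H : A -> Prop) :
  two_sided_hom_ideal (fun x y => alpha (mu x y)) alpha H -> trivial_or_full H.
Proof.
move=> [[[H0 Hlin] HI] Ha].
have [alin [g ag ga] aM] := autA.
have glin : linear g.
  by move=> c x y; apply: (can_inj ag); rewrite alin !ga.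
have gM x y : g (mu x y) = mu (g x) (g y).
  by apply: (can_inj ag); rewrite aM !ga.
have a0 : alpha 0 = 0.
  have := alin 1 0 0; rewrite !scale1r addr0 => e.
  by apply: (addrI (alpha 0)); rewrite addr0 -e.
have g0 : g 0 = 0 by rewrite -[in LHS]a0 ag.
pose X x := H (g (g x)).
have subX : subspace X.
  by split=> [|c x y]; rewrite /X ?g0 // !glin; apply: Hlin.
have XH x : X x -> H x by move=> /Ha; rewrite ga => /Ha; rewrite ga.
(* A word of length j on X lies in alpha^(2 - j) H. *)
have word_level j y : word_span mu X j y -> (j <= 2)%N -> H (iter (2 - j) g y).
  have iter0 k : iter k g 0 = 0 by elim: k => //= k ->.
  have iter_lin k c x z : iter k g (c *: x + z) = c *: iter k g x + iter k g z.
    by elim: k => //= k ->; rewrite glin.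
  have iterM k x z : iter k g (mu x z) = mu (iter k g x) (iter k g z).
    by elim: k => //= k ->; rewrite gM.
  elim=> {j y}
    [j x Xx le_j2|j _|j c x z _ IHx _ IHz le_j2|j a x _ IHx lt_j2|j a x _ IHx lt_j2].
  - by case: j le_j2 => [|[|[|]]] //= _; [rewrite -[g x]ga; apply: Ha | apply: XH].
  - by rewrite iter0.
  - by rewrite iter_lin; apply: Hlin; auto.
  - rewrite iterM; move/(_ (ltnW lt_j2)): IHx; rewrite -(subnSK lt_j2) /=.
    set k := (2 - j.+1)%N => /(HI (g (iter k g a))) [+ _].
    by rewrite aM !ga.
  - rewrite iterM; move/(_ (ltnW lt_j2)): IHx; rewrite -(subnSK lt_j2) /=.
    set k := (2 - j.+1)%N => /(HI (g (iter k g a))) [_ +].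
    by rewrite aM !ga.
have wordH y : word_span mu X 2 y -> H y by move/word_level; apply.
have deep_words (Y : A -> Prop) : (forall x, Y x -> X x) ->
    two_sided_ideal mu (word_span mu Y 2) ->
    (forall x, Y x -> x = 0) \/ (forall x, H x).
  move=> YX /simpleA [W0|Wfull].
    by left=> x Yx; apply/W0/word_gen.
  by right=> x; apply/wordH/(word_mono YX)/Wfull.
have X_trivial : (forall x, X x -> x = 0) -> forall x, H x -> x = 0.
  move=> X0 x Hx; apply/(can_inj ag)/(can_inj ag).
  by rewrite !a0; apply: X0; rewrite /X !ag.
have [red|nuc] := words_reduce_or_nuclear.
  have idealX : two_sided_ideal mu (word_span mu X 2).
    apply: (word_span2_ideal altA subX) => x Xx a b c; have [Wr Wl] := red x a b c.
      by apply: word_mono Wr => y <-.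
    by apply: word_mono Wl => y <-.
  have [X0|Hfull] := deep_words _ (fun x Xx => Xx) idealX; last by right.
  by left; apply: X_trivial.
have Hiter n x : H x -> H (iter n alpha x) by move=> Hx; elim: n => //= n; apply: Ha.
have iter0 k : iter k alpha 0 = 0 by elim: k => //= k ->.
have iterM k x z : iter k alpha (mu x z) = mu (iter k alpha x) (iter k alpha z).
  by elim: k => //= k ->; rewrite aM.
have iter_lin k c x z :
    iter k alpha (c *: x + z) = c *: iter k alpha x + iter k alpha z.
  by elim: k => //= k ->; rewrite alin.
(* The elements that some power of [alpha] brings into [H] form an ideal of the
   original product.  It is needed to move a nonzero nuclear element into [X]. *)
pose absorbed x := exists n, H (iter n alpha x).
have absorbed_ideal : two_sided_ideal mu absorbed.
  split=> [|a b [n Hb]].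
    split=> [|c x z [n Hx] [m Hz]]; first by exists 0%N.
    exists (n + m)%N; rewrite iter_lin; apply: Hlin.
      by rewrite addnC iterD; apply: Hiter.
    by rewrite iterD; apply: Hiter.
  by have [? ?] := HI (iter n alpha a) _ Hb; split; exists n.+1; rewrite /= iterM.
have [absorbed0|absorbing] := simpleA absorbed_ideal.
  by left=> x Hx; apply: absorbed0; exists 0%N.
pose Y x := nuclear mu x /\ X x.
have subY : subspace Y.
  have [nuc0 nuc_lin] := nuclear_subspace altA; have [X0 X_lin] := subX.
  by split=> [|c x z [? ?] [? ?]]; split; auto.
have YX x : Y x -> X x by case.
have idealY : two_sided_ideal mu (word_span mu Y 2).
  by apply: (nuclear_word_ideal altA subY) => x [].
have [Y0|Hfull] := deep_words _ YX idealY; last by right.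
have nuc0 n : nuclear mu n -> n = 0.
  move=> nuc_n; have [k Hk] := absorbing n.
  suff : iter k.+2 alpha n = 0.
    by elim: k.+2 => //= m IHm am0; apply: IHm; apply: (can_inj ag); rewrite am0 a0.
  apply: Y0; split; last by rewrite /X /= !ag.
  elim: k.+2 => //= m nuc_m a b; rewrite -[a]ga -[b]ga /associator -!aM.
  rewrite -(scaleN1r (alpha _)) addrC -alin scaleN1r addrC.
  by have := nuc_m (g a) (g b); rewrite /associator => ->.
have [x [y /eqP[]]] := prodA; suff -> : x = 0 by rewrite (alt_mul0l altA).
by apply: (nuc0) => a b; apply: (nuc0); apply: nuc.
Qed.

End Twist.

Lemma alt_twist_simple (K : fieldType) (A : lmodType K) (mu : A -> A -> A)
    (alpha : A -> A) (charK0 : [pchar K] =i pred0) :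
  simple_alternative_algebra mu -> algebra_automorphism mu alpha ->
  simple_hom_alternative_algebra (fun x y => alpha (mu x y)) alpha.
Proof.
move=> [altA [x0 [y0 mu_neq0]] simpleA] autA; have [alin abij aM] := autA.
have aB x y : alpha (x - y) = alpha x - alpha y.
  by rewrite -scaleN1r addrC alin scaleN1r addrC.
have alpha0 : alpha 0 = 0 by have := aB 0 0; rewrite !subrr.
have amu_neq0 : alpha (mu x0 y0) != 0.
  apply: contraNneq mu_neq0 => amu0.
  by apply/eqP/(bij_inj abij); rewrite amu0 alpha0.
have hom_asc x y z : hom_associator (fun x y => alpha (mu x y)) alpha x y z =
    alpha (alpha (associator mu x y z)).
  by rewrite /hom_associator /associator !aB !aM.
have [[mul_l mul_r] alt_l alt_r] := altA.
split.
- split; last 2 first.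
  + by move=> x y; rewrite hom_asc alt_l !alpha0.
  + by move=> x y; rewrite hom_asc alt_r !alpha0.
  split; last by move=> x y /=; rewrite !aM.
  split=> //; split=> u c x y /=.
    by have /= -> := mul_l u c x y; rewrite alin.
  by have /= -> := mul_r u c x y; rewrite alin.
- by exists (mu x0 y0).
- by exists x0, y0.
- by move=> H; apply: twist_ideal_trivial => //; exists x0, y0.
Qed.

(** * Minimal and simple ideals in finite dimension *)

Section MinimalIdeals.
Variables (K : fieldType) (A : vectType K) (mu : A -> A -> A).
Hypothesis altA : alternative_algebra mu.
Implicit Types U V W : {vspace A}.

Definition ideal V : Prop := forall a b, b \in V -> mu a b \in V /\ mu b a \in V.

Definition minimal_ideal V : Prop :=
  [/\ ideal V, V != 0%VS &
    forall W, ideal W -> (W <= V)%VS -> W = 0%VS \/ W = V].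

Lemma two_sided_idealP V : two_sided_ideal mu (fun x => x \in V) <-> ideal V.
Proof.
split=> [[_ idV] a b Vb|idV]; first exact: idV.
by split=> //; split=> [|c x y Vx Vy]; rewrite ?mem0v // memvD ?memvZ.
Qed.

Lemma ideal_cap V W : ideal V -> ideal W -> ideal (V :&: W).
Proof.
move=> idV idW a b /memv_capP[Vb Wb]; rewrite !memv_cap.
by have [-> ->] := idV a b Vb; have [-> ->] := idW a b Wb.
Qed.

Lemma mul_suml (I : finType) (P : pred I) (F : I -> A) x :
  mu (\sum_(i | P i) F i) x = \sum_(i | P i) mu (F i) x.
Proof.
by apply: (big_morph (mu^~ x)) => [y z|]; rewrite ?(alt_mulDl altA) ?(alt_mul0l altA).
Qed.

Lemma mul_sumr (I : finType) (P : pred I) (F : I -> A) x :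
  mu x (\sum_(i | P i) F i) = \sum_(i | P i) mu x (F i).
Proof.
by apply: (big_morph (mu x)) => [y z|]; rewrite ?(alt_mulDr altA) ?(alt_mul0r altA).
Qed.

Lemma ideal_sum (I : finType) (P : pred I) (V : I -> {vspace A}) :
  (forall i, P i -> ideal (V i)) -> ideal (\sum_(i | P i) V i)%VS.
Proof.
move=> idV a b /memv_sumP[v Vv ->]; rewrite mul_sumr mul_suml.
by split; apply: memv_sumr => i Pi; have [] := idV i Pi a (v i) (Vv i Pi).
Qed.

Lemma ideal_mul_cap V W x y :
  ideal V -> ideal W -> (V :&: W = 0)%VS -> x \in V -> y \in W -> mu x y = 0.
Proof.
move=> idV idW VW0 Vx Wy; apply/eqP; rewrite -memv0 -VW0 memv_cap.
by have [_ ->] := idV y x Vx; have [-> _] := idW x y Wy.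
Qed.

Lemma minimal_cap V W :
  minimal_ideal V -> ideal W -> (V :&: W != 0)%VS -> (V <= W)%VS.
Proof.
move=> [idV _ minV] idW VW_neq0.
have [VW0|/capv_idPl //] := minV _ (ideal_cap idV idW) (capvSl _ _).
by rewrite VW0 eqxx in VW_neq0.
Qed.

Lemma minimal_ideal_exists V :
  ideal V -> V != 0%VS -> exists W, minimal_ideal W.
Proof.
move: {2}(\dim V) (leqnn (\dim V)) => n; elim: n V => [|n IHn] V.
  by rewrite leqn0 dimv_eq0 => /eqP ->; rewrite eqxx.
move=> dimV idV V_neq0.
have [[W [idW WV W_neq0 W_neqV]]|noW] :=
  classic (exists W, [/\ ideal W, (W <= V)%VS, W != 0%VS & W != V]).
  apply: (IHn W) => //; rewrite -ltnS (leq_trans _ dimV) //.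
  by rewrite ltn_neqAle (dimv_leqif_eq WV) W_neqV (dimvS WV).
exists V; split=> // W idW WV.
have [->|W_neq0] := eqVneq W 0%VS; first by left.
have [->|W_neqV] := eqVneq W V; first by right.
by case: noW; exists W.
Qed.

(** A subspace given by a predicate is the largest subspace contained in it,
    found by adding one line at a time. *)
Lemma subspace_vspace (H : A -> Prop) :
  subspace H -> exists V, forall x, x \in V <-> H x.
Proof.
move=> [H0 Hlin].
suff grow n V : (forall x, x \in V -> H x) ->
    (\dim (fullv : {vspace A}) - \dim V <= n)%N ->
    exists V, forall x, x \in V <-> H x.
  by apply: (grow _ 0%VS _ (leqnn _)) => x; rewrite memv0 => /eqP ->.
elim: n V => [|n IHn] V VH; first last.
  have [[x [Hx nVx]] dimV|noV _] := classic (exists x, H x /\ x \notin V).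
    apply: (IHn (V + <[x]>)%VS) => [_ /memv_addP[v Vv [_ /vlineP[c ->] ->]]|].
      by rewrite addrC; apply: Hlin => //; apply: VH.
    have ltV : (\dim V < \dim (V + <[x]>))%N.
      rewrite ltn_neqAle (dimv_leqif_eq (addvSl _ _)) dimvS ?addvSl // andbT.
      by apply: contra nVx => /eqP ->; apply: (subvP (addvSr _ _)); apply: memv_line.
    by rewrite -ltnS (leq_trans _ dimV) // ltn_sub2l // (leq_trans ltV) // dimvS ?subvf.
  exists V => x; split=> [|Hx]; first exact: VH.
  by apply: contraT => nVx; case: noV; exists x.
rewrite leqn0 subn_eq0 => dimV; exists V => x; split=> [|_]; first exact: VH.
suff -> : V = fullv by exact: memvf.
by apply/eqP; rewrite eqEdim subvf.
Qed.

Lemma vsval_restr U (x y : subvs_of U) :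
  ideal U -> vsval (restr_mul mu x y) = mu (vsval x) (vsval y).
Proof. by move=> idU; rewrite vsprojK //; have [] := idU (vsval x) (vsval y) (subvsP y). Qed.

Lemma restr_alternative U : ideal U -> alternative_algebra (@restr_mul K A mu U).
Proof.
move=> idU; have [[mul_l mul_r] alt_l alt_r] := altA.
split.
- split=> u c x y; apply: subvs_inj; rewrite /= !vsval_restr // !linearP /=.
    by have /= -> := mul_l (vsval u) c (vsval x) (vsval y).
  by have /= -> := mul_r (vsval u) c (vsval x) (vsval y).
- move=> x y; apply: subvs_inj; rewrite /associator linearB /= !vsval_restr //.
  by rewrite ?linear0; apply: alt_l.
- move=> x y; apply: subvs_inj; rewrite /associator linearB /= !vsval_restr //.
  by rewrite ?linear0; apply: alt_r.
Qed.

(** As [U W = W U = 0], an ideal of the algebra [U] is an ideal of [A]. *)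
Lemma minimal_simple U W :
    minimal_ideal U -> ideal W -> (U + W = fullv)%VS -> (U :&: W = 0)%VS ->
    (exists x y, [/\ x \in U, y \in U & mu x y != 0]) ->
  simple_ideal mu U.
Proof.
move=> [idU _ minU] idW UWfull UW0 [x [y [Ux Uy xy_neq0]]].
split; [exact/two_sided_idealP | split; first exact: restr_alternative].
  exists (vsproj U x), (vsproj U y); apply: contra xy_neq0 => /eqP /(congr1 vsval).
  by rewrite vsval_restr // !vsprojK // linear0 => ->.
move=> H [subH idH]; have [H0 Hlin] := subH.
pose H' x := exists2 h, H h & x = vsval h.
have [|V VH'] := @subspace_vspace H'.
  split=> [|c _ _ [h Hh ->] [k Hk ->]]; first by exists 0; rewrite ?linear0.
  by exists (c *: h + k); rewrite ?linearP //; apply: Hlin.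
have idV : ideal V.
  move=> a _ /VH' [h Hh ->].
  have : a \in (U + W)%VS by rewrite UWfull memvf.
  case/memv_addP=> u Uu [w Ww ->].
  have [hu uh] := idH (vsproj U u) h Hh.
  rewrite (alt_mulDl altA) (alt_mulDr altA).
  have wh0 : mu w (vsval h) = 0.
    by apply: (ideal_mul_cap idW idU _ Ww (subvsP h)); rewrite capvC.
  rewrite wh0 (ideal_mul_cap idU idW UW0 (subvsP h) Ww) !addr0; split; apply/VH'.
    by exists (restr_mul mu (vsproj U u) h); rewrite ?vsval_restr ?vsprojK.
  by exists (restr_mul mu h (vsproj U u)); rewrite ?vsval_restr ?vsprojK.
have VU : (V <= U)%VS by apply/subvP=> _ /VH' [h _ ->]; apply: subvsP.
have [V0|VeqU] := minU _ idV VU; [left|right] => h.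
  move=> Hh; apply/subvs_inj/eqP; rewrite linear0 -memv0 -V0; apply/VH'.
  by exists h.
have /VH' [k Hk /subvs_inj ->] // : vsval h \in V by rewrite VeqU subvsP.
Qed.

Lemma simple_minimal U : simple_ideal mu U -> minimal_ideal U.
Proof.
case=> /two_sided_idealP idU [_ [x [y xy_neq0]] simpleU].
split=> // [|W idW WU].
  apply: contra xy_neq0 => /eqP U0; apply/eqP/subvs_inj/eqP.
  by rewrite linear0 -memv0 -U0 subvsP.
have [|W0|Wfull] := simpleU (fun h => vsval h \in W).
- split=> [|a b Wb]; last by rewrite !vsval_restr //; apply: idW.
  by split=> [|c u v Wu Wv]; rewrite ?linear0 ?mem0v // linearP memvD ?memvZ.
- left; apply/eqP; rewrite -subv0; apply/subvP=> w Ww.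
  have Uw := subvP WU w Ww.
  by rewrite memv0 -(vsprojK Uw) (W0 (vsproj U w)) ?linear0 // vsprojK.
right; apply/eqP; rewrite eqEsubv WU; apply/subvP=> u Uu.
by rewrite -(vsprojK Uu); apply: Wfull.
Qed.

(** Otherwise [V] would meet every summand trivially, so that
    [V (U i) = 0] for all [i], and [V] would annihilate the whole algebra. *)
Lemma minimal_in_decomposition m (U : 'I_m -> {vspace A}) V :
    simple_decomposition mu U -> minimal_ideal V ->
    (exists x y, [/\ x \in V, y \in V & mu x y != 0]) ->
  exists i, V = U i.
Proof.
move=> [simpleU [_ sumU]] minV [x [y [Vx Vy /eqP xy_neq0]]].
have [/existsP[i /eqP]|] := boolP [exists i, V == U i]; first by exists i.
rewrite negb_exists => /forallP V_neqU; case: xy_neq0.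
have [idV _ _] := minV.
have : y \in (\sum_i U i)%VS by rewrite sumU memvf.
case/memv_sumP=> u Uu ->; rewrite mul_sumr big1 // => i _.
have minUi := simple_minimal (simpleU i); have [idUi _ _] := minUi.
apply: (ideal_mul_cap idV idUi) => //; last exact: Uu.
apply: contraNeq (V_neqU i) => VUi_neq0.
by rewrite eqEsubv !minimal_cap // capvC.
Qed.

End MinimalIdeals.

(** * Orbits of ideals under an automorphism *)

Section AutomorphismOrbit.
Variables (K : fieldType) (A : vectType K) (mu : A -> A -> A) (alpha : 'End(A)).
Hypothesis altA : alternative_algebra mu.
Hypothesis kera : lker alpha == 0%VS.
Hypothesis alphaM : {morph alpha : x y / mu x y}.
Hypothesis prodA : exists x y, mu x y != 0.
Hypothesis invariant_trivial : forall H : A -> Prop,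
  two_sided_ideal mu H -> (forall x, H x -> H (alpha x)) -> trivial_or_full H.
Implicit Types U V W : {vspace A}.

Lemma img_vK V : ((alpha^-1)%VF @: (alpha @: V) = V)%VS.
Proof. by rewrite -limg_comp lker0_compVf // lim1g. Qed.

Lemma img_Kv V : (alpha @: ((alpha^-1)%VF @: V) = V)%VS.
Proof. by rewrite -limg_comp lker0_compfV // lim1g. Qed.

Lemma ideal_img V : ideal mu V -> ideal mu (alpha @: V).
Proof.
move=> idV a _ /memv_imgP[v Vv ->]; rewrite -[a](lker0_lfunVK kera) -!alphaM.
by have [? ?] := idV ((alpha^-1)%VF a) v Vv; split; apply: memv_img.
Qed.

Lemma ideal_preimg V : ideal mu V -> ideal mu ((alpha^-1)%VF @: V).
Proof.
move=> idV a _ /memv_imgP[v Vv ->]; have [Vav Vva] := idV (alpha a) v Vv.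
rewrite -[mu a _](lker0_lfunK kera) -[mu _ a](lker0_lfunK kera) !alphaM.
by rewrite !(lker0_lfunVK kera); split; apply: memv_img.
Qed.

Lemma minimal_img V : minimal_ideal mu V -> minimal_ideal mu (alpha @: V).
Proof.
move=> [idV V_neq0 minV]; split; first exact: ideal_img.
  by apply: contra V_neq0 => /eqP aV0; rewrite -[V]img_vK aV0 limg0.
move=> W idW WaV; rewrite -[W]img_Kv.
have WV : ((alpha^-1)%VF @: W <= V)%VS by rewrite -[V]img_vK limgS.
by have [->|->] := minV _ (ideal_preimg idW) WV; [left; rewrite limg0 | right].
Qed.

Lemma minimal_iter k V : minimal_ideal mu V -> minimal_ideal mu (iter_image alpha k V).
Proof. by move=> minV; elim: k => //= k; apply: minimal_img. Qed.

Lemma invariant_full V :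
  ideal mu V -> V != 0%VS -> (alpha @: V <= V)%VS -> V = fullv.
Proof.
move=> /two_sided_idealP idV V_neq0 /subvP aV.
have [|V0|Vfull] := invariant_trivial idV.
- by move=> x Vx; apply/aV/memv_img.
- case/eqP: V_neq0; apply/eqP; rewrite -subv0; apply/subvP=> x Vx.
  by rewrite memv0 (V0 x Vx).
by apply/eqP; rewrite eqEsubv subvf; apply/subvP=> x _; apply: Vfull.
Qed.

(** The images of [V] cannot be independent for ever.  As long as they are, the
    dimension of their sum grows; the first image that meets the sum of the
    previous ones is contained in it, and the sum is then invariant. *)
Lemma orbit_decomposition V : minimal_ideal mu V ->
  exists m, direct_sum (fun k : 'I_m => iter_image alpha k V).
Proof.
move=> minV; pose S m := (\sum_(k < m) iter_image alpha k V)%VS.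
have minI k := minimal_iter k minV.
have idI k : ideal mu (iter_image alpha k V) by case: (minI k).
have S_recr m : S m.+1 = (S m + iter_image alpha m V)%VS by rewrite /S big_ord_recr.
have stop : exists m, (iter_image alpha m V :&: S m != 0)%VS.
  have [//|no_stop] := classic (exists m, (iter_image alpha m V :&: S m != 0)%VS).
  have dimS m : (m <= \dim (S m))%N.
    elim: m => // m IHm; rewrite S_recr dimv_disjoint_sum; last first.
      by apply/eqP/contraT => cap; case: no_stop; exists m; rewrite capvC.
    rewrite -addn1 leq_add // lt0n dimv_eq0.
    by case: (minI m).
  have := leq_trans (dimS (\dim (fullv : {vspace A})).+1) (dimvS (subvf _)).
  by rewrite ltnn.
case: (ex_minnP stop) => m capm minm; exists m.
have dimS j : (j <= m)%N -> \dim (S j) = (\sum_(k < j) \dim (iter_image alpha k V))%N.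
  elim: j => [|j IHj] lt_jm; first by rewrite /S !big_ord0 dimv0.
  rewrite S_recr dimv_disjoint_sum ?IHj 1?ltnW ?big_ord_recr //.
  by apply/eqP; apply: contraTT lt_jm => capj; rewrite -leqNgt minm // capvC.
split; first by apply/directvP; rewrite /= -/(S m) dimS.
apply: invariant_full.
- by apply: ideal_sum.
- by apply: contra capm => /eqP S0; rewrite /S S0 capv0.
rewrite limg_sum; apply/subv_sumP => k _; change (iter_image alpha k.+1 V <= S m)%VS.
have := ltn_ord k; rewrite leq_eqVlt => /predU1P[->|lt_km].
  by apply: (minimal_cap (minI m) _ capm); apply: ideal_sum.
exact: (sumv_sup (Ordinal lt_km)).
Qed.

(** If all products in [V] vanished, [V] would annihilate the direct sum of its
    images, which is [A]; but the annihilator of [A] is an invariant ideal. *)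
Lemma minimal_mul V :
  minimal_ideal mu V -> exists x y, [/\ x \in V, y \in V & mu x y != 0].
Proof.
move=> minV; have [//|noprod] :=
  classic (exists x y, [/\ x \in V, y \in V & mu x y != 0]).
have VV0 x y : x \in V -> y \in V -> mu x y = 0.
  by move=> Vx Vy; apply/eqP/contraT => xy_neq0; case: noprod; exists x, y.
pose annihilator x := forall a, mu a x = 0 /\ mu x a = 0.
have ann_ideal : two_sided_ideal mu annihilator.
  split.
    split=> [a|c x y Nx Ny a]; first by rewrite (alt_mul0l altA) (alt_mul0r altA).
    have [ax0 xa0] := Nx a; have [ay0 ya0] := Ny a.
    rewrite (alt_mulDl altA) (alt_mulDr altA) (alt_mulZl altA) (alt_mulZr altA).
    by rewrite ax0 xa0 ay0 ya0 scaler0 addr0.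
  move=> a x Nx; have [-> ->] := Nx a.
  by split=> b; rewrite (alt_mul0l altA) (alt_mul0r altA).
have [x Nx|ann0|annA] := invariant_trivial ann_ideal.
- move=> a; rewrite -[a](lker0_lfunVK kera) -!alphaM.
  by have [-> ->] := Nx ((alpha^-1)%VF a); rewrite linear0.
- have [idV V_neq0 _] := minV.
  have [m [/directv_sumP dirS sumS]] := orbit_decomposition minV.
  have m_gt0 : (0 < m)%N.
    case: m dirS sumS => // _; rewrite big_ord0 => A0.
    by rewrite -subv0 A0 subvf in V_neq0.
  pose i0 := Ordinal m_gt0.
  case/eqP: V_neq0; apply/eqP; rewrite -subv0; apply/subvP=> x Vx.
  rewrite memv0; apply/eqP/ann0 => a.
  have : a \in (\sum_(k < m) iter_image alpha k V)%VS by rewrite sumS memvf.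
  rewrite (bigD1 i0) //= => /memv_addP[v Vv [w Ww ->]].
  have idW : ideal mu (\sum_(k < m | k != i0) iter_image alpha k V)%VS.
    by apply: ideal_sum => // k _; case: (minimal_iter k minV).
  have cap0 := dirS i0 isT; rewrite /= in cap0.
  rewrite (alt_mulDl altA) (alt_mulDr altA) (VV0 v x Vv Vx) (VV0 x v Vx Vv) !add0r.
  split.
    by apply: (ideal_mul_cap idW idV _ Ww Vx); rewrite capvC.
  exact: (ideal_mul_cap idV idW _ Vx Ww).
have [x [y /eqP[]]] := prodA; by have [] := annA y x.
Qed.

Lemma orbit_simple_decomposition V : minimal_ideal mu V ->
  exists m, simple_decomposition mu (fun k : 'I_m => iter_image alpha k V).
Proof.
move=> minV; have [m [dirS sumS]] := orbit_decomposition minV; exists m.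
split=> // i; have /directv_sumP capS := dirS.
apply: (@minimal_simple _ _ _ altA _ (\sum_(k < m | k != i) iter_image alpha k V)%VS).
- exact: minimal_iter.
- by apply: ideal_sum => // k _; case: (minimal_iter k minV).
- by rewrite -sumS [RHS](bigD1 i).
- exact: capS.
exact/minimal_mul/minimal_iter.
Qed.

(** Write [alpha (U i) = U (s i)].  The sum of the [U i] over the orbit of [i0]
    under [s] is an invariant ideal, so the orbit consists of all [m] indices
    and they are the [s^k i0] for [k < m]. *)
Lemma simple_transitivity m (U : 'I_m -> {vspace A}) :
  simple_decomposition mu U -> acts_simply_transitively alpha U.
Proof.
move=> decU i0; have [simpleU [dirU sumU]] := decU.
have minU i := simple_minimal (simpleU i).
have capU := directv_sumP dirU.
have [s alphaU] : exists s : 'I_m -> 'I_m, forall i, (alpha @: U i)%VS = U (s i).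
  apply: (@fin_all_exists _ _ (fun i j => (alpha @: U i)%VS = U j)) => i.
  apply: (minimal_in_decomposition altA decU (minimal_img (minU i))).
  exact/minimal_mul/minimal_img.
have U_inj : injective U.
  move=> i j eqU; apply/eqP/contraT => neq_ij.
  have [_ Ui_neq0 _] := minU i; case/eqP: Ui_neq0.
  apply/eqP; rewrite -subv0 -(capU i isT) subv_cap subvv /= eqU.
  by apply: (sumv_sup j) => //=; rewrite eq_sym.
have s_inj : injective s.
  move=> i j eqs; apply: U_inj; rewrite -[U i]img_vK -[U j]img_vK.
  by rewrite !alphaU eqs.
have iterU k : iter_image alpha k (U i0) = U (iter k s i0).
  by elim: k => //= k ->; apply: alphaU.
pose orb := (\sum_(i | fconnect s i0 i) U i)%VS.
have orb_full : orb = fullv.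
  apply: invariant_full.
  - by apply: ideal_sum => // i _; case: (minU i).
  - have [_ Ui0 _] := minU i0; apply: contra Ui0; rewrite -!subv0; apply: subv_trans.
    by apply: (sumv_sup i0) => //; apply: connect0.
  rewrite limg_sum; apply/subv_sumP => i conn_i; rewrite alphaU.
  apply: (sumv_sup (s i)) => //; apply: (connect_trans conn_i); exact: fconnect1.
have conn i : fconnect s i0 i.
  apply: contraT => nconn; have [_ Ui_neq0 _] := minU i; case/eqP: Ui_neq0.
  apply/eqP; rewrite -subv0 -(capU i isT) subv_cap subvv /=.
  rewrite (subv_trans (subvf _)) // -orb_full; apply/subv_sumP => j conn_j.
  by apply: (sumv_sup j) => //=; apply: contraNneq nconn => <-.
have order_m : fingraph.order s i0 = m.
  by rewrite /fingraph.order -[RHS]card_ord; apply: eq_card => i; rewrite !inE conn.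
have orbit_inj : injective (fun k : 'I_m => iter k s i0).
  move=> k l eq_kl; apply/ord_inj/eqP.
  have := fingraph.orbit_uniq s i0; rewrite /fingraph.orbit order_m => uniq_s.
  rewrite -(nth_uniq i0 _ _ uniq_s) ?size_traject //.
  by rewrite !nth_traject //; apply/eqP.
pose p := perm orbit_inj.
have pU (k : 'I_m) : iter_image alpha k (U i0) = U (p k) by rewrite iterU permE.
split; last by exists p.
have sum_p : (\sum_(k < m) iter_image alpha k (U i0) = \sum_(i < m) U i)%VS.
  by rewrite [RHS](reindex_perm p); apply: eq_bigr => k _; exact: pU.
split; last by rewrite sum_p.
apply/directvP; rewrite /= sum_p (directvP dirU) /= (reindex_perm p) /=.
by apply: eq_bigr => k _; rewrite pU.
Qed.

Lemma iter_image_isomorphic k U V :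
  ideal mu U -> ideal mu V -> iter_image alpha k U = V ->
  algebra_isomorphic (@restr_mul K A mu U) (@restr_mul K A mu V).
Proof.
move=> idU idV eqV.
have iterV x : x \in U -> iter k alpha x \in V.
  by rewrite -eqV; elim: (k) => //= n IHn /IHn; apply: memv_img.
have iterU x : x \in V -> iter k (alpha^-1)%VF x \in U.
  rewrite -eqV; elim: (k) x => // n IHn y; rewrite iterSr => /memv_imgP[x Wx ->].
  by rewrite lker0_lfunK //; apply: IHn.
have iterK : cancel (iter k alpha) (iter k (alpha^-1)%VF).
  by elim: (k) => // n IHn x; rewrite (iterSr n (alpha^-1)%VF) (iterS n alpha) lker0_lfunK.
have iterVK : cancel (iter k (alpha^-1)%VF) (iter k alpha).
  by elim: (k) => // n IHn x; rewrite (iterSr n alpha) (iterS n (alpha^-1)%VF) lker0_lfunVK.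
have iterM : {morph iter k alpha : x y / mu x y}.
  by elim: (k) => [|n IHn] x y //=; rewrite IHn alphaM.
have iter_lin c x y : iter k alpha (c *: x + y) = c *: iter k alpha x + iter k alpha y.
  by elim: (k) => //= n ->; rewrite linearP.
exists (fun x => vsproj V (iter k alpha (vsval x))); split.
- by move=> c x y; rewrite linearP iter_lin linearP.
- exists (fun y => vsproj U (iter k (alpha^-1)%VF (vsval y))) => [x|y].
    by rewrite vsprojK ?iterV ?subvsP // iterK vsvalK.
  by rewrite vsprojK ?iterU ?subvsP // iterVK vsvalK.
move=> x y; apply: subvs_inj; rewrite [RHS]vsval_restr // (vsval_restr x y idU).
rewrite ![in RHS]vsprojK ?iterV ?subvsP // -iterM vsprojK // iterV //.
by have [] := idU (vsval x) (vsval y) (subvsP y).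
Qed.

End AutomorphismOrbit.

(** * The induced algebra of a simple Hom-alternative algebra *)

Section InducedAlgebra.
Variables (K : fieldType) (A : vectType K) (mu : A -> A -> A) (alpha : 'End(A)).
Hypothesis simpleA : simple_hom_alternative_algebra mu alpha.

Local Notation mu' := (induced_mul mu alpha).

(** The kernel of [alpha] is a Hom-ideal by multiplicativity. *)
Lemma hom_simple_lker : lker alpha == 0%VS.
Proof.
have [[[[[mul_l mul_r] _] aM] _ _] [z az_neq0] _ idA] := simpleA.
have mul0l b : mu 0 b = 0.
  have := mul_l b 1 0 0; rewrite /= !scale1r addr0 => e.
  by apply: (addrI (mu 0 b)); rewrite addr0 -e.
have mul0r b : mu b 0 = 0.
  have := mul_r b 1 0 0; rewrite /= !scale1r addr0 => e.
  by apply: (addrI (mu b 0)); rewrite addr0 -e.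
have ker_ideal : two_sided_hom_ideal mu alpha (fun x => x \in lker alpha).
  split; last by move=> x; rewrite memv_ker => /eqP ->; apply: mem0v.
  split; first by split=> [|c x y kx ky]; rewrite ?mem0v // memvD ?memvZ.
  by move=> a b; rewrite !memv_ker !aM => /eqP ->; rewrite mul0l mul0r.
have [ker0|ker_full] := idA _ ker_ideal.
  by rewrite -subv0; apply/subvP=> x /ker0 ->; apply: mem0v.
by have := ker_full z; rewrite memv_ker (negPf az_neq0).
Qed.

Lemma alpha_induced x y : alpha (mu' x y) = mu x y.
Proof. exact: (lker0_lfunVK hom_simple_lker). Qed.

Lemma induced_alphaM : {morph alpha : x y / mu' x y}.
Proof.
have [[[_ aM] _ _] _ _ _] := simpleA.
by move=> x y; rewrite alpha_induced /induced_mul -aM (lker0_lfunK hom_simple_lker).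
Qed.

Lemma induced_automorphism : algebra_automorphism mu' alpha.
Proof.
split; [exact: linearP | | exact: induced_alphaM].
by exists (alpha^-1)%VF; [apply: lker0_lfunK|apply: lker0_lfunVK]; exact: hom_simple_lker.
Qed.

(** The Hom-associator is [alpha^2] applied to the associator of the induced
    product. *)
Lemma induced_alternative : alternative_algebra mu'.
Proof.
have [[[[[mul_l mul_r] _] aM] alt_l alt_r] _ _ _] := simpleA.
have asc_hom x y z :
    hom_associator mu alpha x y z = alpha (alpha (associator mu' x y z)).
  by rewrite /hom_associator /associator !linearB /= !alpha_induced !aM !alpha_induced.
have /lker0P alpha_inj := hom_simple_lker.
split.
- split=> u c x y; rewrite /induced_mul /=.
    by have /= -> := mul_l u c x y; rewrite linearP.
  by have /= -> := mul_r u c x y; rewrite linearP.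
- by move=> x y; do 2!apply: (alpha_inj); rewrite -asc_hom alt_l !linear0.
- by move=> x y; do 2!apply: (alpha_inj); rewrite -asc_hom alt_r !linear0.
Qed.

Lemma induced_prod : exists x y, mu' x y != 0.
Proof.
have [_ _ [x [y xy_neq0]] _] := simpleA; exists x, y.
by apply: contra xy_neq0; rewrite -alpha_induced => /eqP ->; rewrite linear0.
Qed.

(** An invariant ideal of the induced product is closed under [mu], which is
    the induced product followed by [alpha]. *)
Lemma induced_invariant_trivial (H : A -> Prop) :
  two_sided_ideal mu' H -> (forall x, H x -> H (alpha x)) -> trivial_or_full H.
Proof.
have [_ _ _ idA] := simpleA; move=> [subH idH] aH; apply: idA; split=> //; split=> //.
by move=> a b /(idH a) [/aH Hab /aH Hba]; rewrite -!alpha_induced.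
Qed.

Lemma induced_decomposition :
  exists (m : nat) (U : 'I_m -> {vspace A}), simple_decomposition mu' U.
Proof.
have altA := induced_alternative; have [x [y xy_neq0]] := induced_prod.
have [||V minV] := @minimal_ideal_exists _ _ mu' fullv.
- by move=> a b _; rewrite !memvf.
- apply: contra xy_neq0; rewrite -subv0 => /subvP /(_ (mu' x y) (memvf _)).
  by rewrite memv0.
have [m decV] := orbit_simple_decomposition altA hom_simple_lker induced_alphaM
  induced_prod induced_invariant_trivial minV.
by exists m, (fun k : 'I_m => iter_image alpha k V).
Qed.

Lemma induced_transitivity m (U : 'I_m -> {vspace A}) :
  simple_decomposition mu' U -> acts_simply_transitively alpha U.
Proof.
exact: (simple_transitivity induced_alternative hom_simple_lker induced_alphaM
  induced_prod induced_invariant_trivial).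
Qed.

Lemma induced_summands_isomorphic m (U : 'I_m -> {vspace A}) (i j : 'I_m) :
  simple_decomposition mu' U ->
  algebra_isomorphic (@restr_mul K A mu' (U i)) (@restr_mul K A mu' (U j)).
Proof.
move=> decU; have [_ [s iterU]] := induced_transitivity decU i.
have idU k : ideal mu' (U k) by have [/(_ k) [/two_sided_idealP]] := decU.
apply: (iter_image_isomorphic (k := (s^-1)%g j) hom_simple_lker induced_alphaM
  (idU i) (idU j)).
by rewrite iterU permKV.
Qed.

End InducedAlgebra.

Theorem theorem4p5 (K : fieldType) (charK0 : [pchar K] =i pred0) :
  (forall (A : vectType K) (mu : A -> A -> A) (alpha : 'End(A)),
     simple_hom_alternative_algebra mu alpha ->
     let mu' := induced_mul mu alpha in
     [/\ algebra_automorphism mu' alpha,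
         semisimple_alternative_algebra mu',
         exists (m : nat) (U : 'I_m -> {vspace A}),
           simple_decomposition mu' U /\
           (forall i j : 'I_m,
              algebra_isomorphic (@restr_mul K A mu' (U i))
                                 (@restr_mul K A mu' (U j)))
       & forall (m : nat) (U : 'I_m -> {vspace A}),
           simple_decomposition mu' U -> acts_simply_transitively alpha U])
  /\
  (forall (A : lmodType K) (mu' : A -> A -> A) (alpha : A -> A),
     simple_alternative_algebra mu' ->
     algebra_automorphism mu' alpha ->
     simple_hom_alternative_algebra (fun x y => alpha (mu' x y)) alpha).
Proof.
split=> [A mu alpha simpleA mu'|A mu' alpha]; last exact: alt_twist_simple.
have [m [U decU]] := induced_decomposition simpleA.
split.
- exact: induced_automorphism.
- by split; [exact: induced_alternative | exists m, U].
- by exists m, U; split=> // i j; apply: induced_summands_isomorphic.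
- exact: induced_transitivity.
Qed.
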